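(* Let $c$ be an $m$-combinator, $\mathcal{D}=\{(\Sigma_k,L_k,G_k)\}_{k}$ a treelike decomposition class, and $C_1,\dots,C_m$ $\mathcal{D}$-coherent treelike DP-cores. Then there exists a $\mathcal{D}$-coherent treelike DP-core $C=C(c,C_1,\dots,C_m)$ such that: (1) $P(C,\mathcal{D})=\hat c\big(P(C_1,\mathcal{D}),\dots,P(C_m,\mathcal{D}),\mathrm{Inv}[C_1,\mathcal{D}],\dots,\mathrm{Inv}[C_m,\mathcal{D}]\big)$; (2) $\beta_C(k,n)=\sum_{i=1}^m\beta_{C_i}(k,n)\cdot\mu_{C_i}(k,n)$; (3) $\mu_C(k,n)=1$; (4) $\delta_C(k,n)=\nu_C(k,n)\le\prod_{i=1}^m\delta_{C_i}(k,n)$.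
   Context: Graphs: a graph is a triple $G=(V,E,I)$ with $V,E$ finite subsets of $\mathbb{N}$ and $I\subseteq E\times V$ (multi-edges allowed); $\simeq$ denotes isomorphism (bijections on vertices and edges preserving incidence); a graph property is an isomorphism-closed set of graphs; the isomorphism closure of a set of graphs is the set of graphs isomorphic to one of its members; $P(G)\in\{0,1\}$ indicates $G\in P$. Terms over a ranked alphabet $\Sigma$ are finite rooted ordered trees labelled by symbols whose arity equals the number of children; $|\tau|$ is the number of nodes. A treelike decomposition class is a sequence $\mathcal{D}=\{(\Sigma_k,L_k,G_k)\}_{k\in\mathbb{N}}$ with $\Sigma_k$ a ranked alphabet, $L_k$ a regular tree language over $\Sigma_k$, $G_k:L_k\to$ graphs, $\Sigma_k\subseteq\Sigma_{k+1}$, $L_k\subseteq L_{k+1}$, $G_{k+1}|_{L_k}=G_k$; write $G(\tau)$. Treelike DP-core: $C=\{C[k]\}_k$, $C[k]=(\Sigma_k,W_k,F_k,T_k,\mathrm{Clean}_k,\mathrm{Inv}_k)$ with $W_k\subseteq\{0,1\}^*$ decidable, $F_k:W_k\to\{0,1\}$ (final witnesses), $T_k$ giving a finite set $\hat a\subseteq W_k$ for each arity-$0$ symbol and a function $\hat a:W_k^p\to$ finite subsets of $W_k$ for each symbol of arity $p\ge1$, $\mathrm{Clean}_k$: finite subsets $\to$ finite subsets of $W_k$, $\mathrm{Inv}_k$: finite subsets $\to\{0,1\}^*$. Set extension $\hat a(S_1,\dots,S_p)=\mathrm{Clean}_k(\bigcup_{w_i\in S_i}\hat a(w_1,\dots,w_p))$.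 Dynamization: $\mathrm{Dyn}_k(a)=\hat a$ for arity $0$, $\mathrm{Dyn}_k(a(\tau_1,\dots,\tau_p))=\hat a(\mathrm{Dyn}_k(\tau_1),\dots,\mathrm{Dyn}_k(\tau_p))$. $\tau$ is accepted by $C[k]$ if $\mathrm{Dyn}_k(\tau)$ has a final witness. $P(C,\mathcal{D})$ is the isomorphism closure of $\{G(\tau):\exists k,\ \tau\in L_k$ accepted by $C[k]\}$. $C$ is $\mathcal{D}$-coherent if its alphabets are the $\Sigma_k$ and for all $\tau\in L_k,\tau'\in L_{k'}$ with $G(\tau)\simeq G(\tau')$: $\tau$ accepted by $C[k]$ iff $\tau'$ accepted by $C[k']$, and $\mathrm{Inv}_k(\mathrm{Dyn}_k(\tau))=\mathrm{Inv}_{k'}(\mathrm{Dyn}_{k'}(\tau'))$. For coherent $C$, $\mathrm{Inv}[C,\mathcal{D}](G)=\mathrm{Inv}_k(\mathrm{Dyn}_k(\tau))$ for any $\tau$ with $G(\tau)\simeq G$ and $k$ the least index with $\tau\in L_k$, defined for $G\in P(C,\mathcal{D})$. Complexity measures: $S\subseteq W_k$ is $(C,k,n)$-useful if $S=\mathrm{Dyn}_k(\tau)$ for a term $\tau$ over $\Sigma_k$ with $|\tau|\le n$; a witness is useful if in some useful set. $\beta_C(k,n)$: max bit-length of a useful witness; $\mu_C(k,n)$: max size of a useful set; $\nu_C(k,n)$: number of useful witnesses; $\delta_C(k,n)$: number of useful sets. An $m$-combinator is a function $c:\{0,1\}^m\times(\{0,1\}^* )^m\to\{0,1\}$; for graph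 properties $P_i$ and invariants $\varphi_i$, $\hat c(P_1,\dots,P_m,\varphi_1,\dots,\varphi_m)=\{G:c(P_1(G),\dots,P_m(G),\varphi_1(G),\dots,\varphi_m(G))=1\}$.
   Formalization: Formal version: in (1) the right side is intersected with the graphs isomorphic to some G(τ); (2) reads β_C = Σ(β_{C_i}+1)·μ_{C_i}, as the stated formula is refutable; (3) is claimed only if some term over Σ_k has at most n nodes. *)

(* Defs.v *)
(* MathComp with classical sets (mathcomp.classical) and finmap. *)
From mathcomp Require Export all_boot finmap.
From mathcomp Require Export boolp classical_sets cardinality.

Set Implicit Arguments.
Unset Strict Implicit.
Unset Printing Implicit Defensive.

Local Open Scope fset_scope.

(** * Graphs *)

Record graph := Graph {
  vertices : {fset nat};
  edges : {fset nat};
  incidence : {fset nat * nat};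
  incidence_sub : incidence `<=` edges `*` vertices
}.

Definition iso (G H : graph) : Prop :=
  exists f g : nat -> nat,
    [/\ {in vertices G &, injective f},
        [fset f v | v in vertices G] = vertices H,
        {in edges G &, injective g},
        [fset g e | e in edges G] = edges H &
        forall e v, e \in edges G -> v \in vertices G ->
          ((e, v) \in incidence G) = ((g e, f v) \in incidence H)].

(** * Terms and regular tree languages *)

(* Symbols live in an ambient type [Sym] with a global arity function [ar]; a
   ranked alphabet is a finite set of symbols, so an inclusion of alphabets
   automatically preserves arities. *)

Inductive term (Sym : Type) : Type := Node of Sym & seq (term Sym).

Fixpoint tsize (Sym : Type) (t : term Sym) : nat :=
  let: Node _ ts := t in (sumn (map (@tsize Sym) ts)).+1.

Fixpoint term_over (Sym : choiceType) (ar : Sym -> nat) (Sg : {fset Sym})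
    (t : term Sym) : bool :=
  let: Node a ts := t in
  [&& a \in Sg, size ts == ar a & all (term_over ar Sg) ts].

(* Nondeterministic bottom-up automata: [trans a qs q] is the transition
   a(q_1, ..., q_p) -> q. *)
Record automaton (Sym : Type) (Q : finType) := Automaton {
  trans : Sym -> seq Q -> pred Q;
  accepting : pred Q
}.

Fixpoint reached (Sym : Type) (Q : finType) (A : automaton Sym Q)
    (t : term Sym) : {set Q} :=
  let: Node a ts := t in
  finset (fun q => [exists qs : (size ts).-tuple Q,
    all2 (fun q' (X : {set Q}) => q' \in X) qs (map (reached A) ts) &&
    trans A a qs q]).

Definition regular (Sym : choiceType) (ar : Sym -> nat) (Sg : {fset Sym})
    (L : set (term Sym)) : Prop :=
  exists (Q : finType) (A : automaton Sym Q), forall t,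
    L t <-> term_over ar Sg t /\ [exists q in reached A t, accepting A q].

(** * Treelike decomposition classes *)

(* [dc_graph D k] is only meaningful on [dc_lang D k]. *)
Record decomp_class (Sym : choiceType) (ar : Sym -> nat) := DecompClass {
  dc_sigma : nat -> {fset Sym};
  dc_lang : nat -> set (term Sym);
  dc_graph : nat -> term Sym -> graph;
  dc_regular : forall k, regular ar (dc_sigma k) (dc_lang k);
  dc_sigma_sub : forall k, dc_sigma k `<=` dc_sigma k.+1;
  dc_lang_sub : forall k, (dc_lang k `<=` dc_lang k.+1)%classic;
  dc_graph_ext : forall k t, dc_lang k t -> dc_graph k.+1 t = dc_graph k t
}.

Definition dc_graphs (Sym : choiceType) (ar : Sym -> nat)
    (D : decomp_class ar) : set graph :=
  [set H | exists k t, dc_lang D k t /\ iso (dc_graph D k t) H]%classic.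

(** * Decidable sets of bitstrings *)

Notation bits := (seq bool).

(* Kleene's partial recursive functions.  A boolean predicate alone would not
   express decidability, since excluded middle is assumed. *)
Inductive recfun : Type :=
| Zero | Succ | Proj of nat | Comp of recfun & seq recfun
| Prim of recfun & recfun | Mu of recfun.

Inductive computes : recfun -> seq nat -> nat -> Prop :=
| computes_zero xs : computes Zero xs 0
| computes_succ x xs : computes Succ (x :: xs) x.+1
| computes_proj i xs : i < size xs -> computes (Proj i) xs (nth 0 xs i)
| computes_comp f gs xs ys y :
    computes_all gs xs ys -> computes f ys y -> computes (Comp f gs) xs y
| computes_prim0 f g xs y :
    computes f xs y -> computes (Prim f g) (0 :: xs) y
| computes_primS f g n xs y z :
    computes (Prim f g) (n :: xs) y -> computes g (n :: y :: xs) z ->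
    computes (Prim f g) (n.+1 :: xs) z
| computes_mu f xs n :
    (forall i, i < n -> exists y, computes f (i :: xs) y.+1) ->
    computes f (n :: xs) 0 -> computes (Mu f) xs n
with computes_all : seq recfun -> seq nat -> seq nat -> Prop :=
| computes_nil xs : computes_all [::] xs [::]
| computes_cons f fs xs y ys :
    computes f xs y -> computes_all fs xs ys ->
    computes_all (f :: fs) xs (y :: ys).

(* Bijective base-2 numeration. *)
Definition bits_code (s : bits) : nat :=
  foldr (fun (b : bool) n => (b + n.*2).+1) 0 s.

Definition decidable_bits (W : pred bits) : Prop :=
  exists f, forall s, computes f [:: bits_code s] (W s).

(** * Treelike DP-cores *)

(* Functions on [W_k] are represented by total functions on bitstrings that
   preserve [W_k]; values outside [W_k] are irrelevant.  [dp_leaf] interprets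
   the symbols of arity 0 and [dp_step] those of positive arity. *)
Record dpcore (Sym : choiceType) (ar : Sym -> nat) := DPCore {
  dp_sigma : nat -> {fset Sym};
  dp_wit : nat -> pred bits;
  dp_final : nat -> pred bits;
  dp_leaf : nat -> Sym -> {fset bits};
  dp_step : nat -> Sym -> seq bits -> {fset bits};
  dp_clean : nat -> {fset bits} -> {fset bits};
  dp_inv : nat -> {fset bits} -> bits;
  dp_wit_dec : forall k, decidable_bits (dp_wit k);
  dp_leaf_wit : forall k a, a \in dp_sigma k -> ar a = 0 ->
    {subset dp_leaf k a <= dp_wit k};
  dp_step_wit : forall k a ws, a \in dp_sigma k -> 0 < ar a ->
    size ws = ar a -> all (dp_wit k) ws -> {subset dp_step k a ws <= dp_wit k};
  dp_clean_wit : forall k (S : {fset bits}),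
    {subset S <= dp_wit k} -> {subset dp_clean k S <= dp_wit k}
}.

Definition selections (Ss : seq {fset bits}) : seq (seq bits) :=
  foldr (fun (S : {fset bits}) acc => [seq w :: ws | w <- S, ws <- acc])
        [:: [::]] Ss.

Definition set_ext (Sym : choiceType) (ar : Sym -> nat) (C : dpcore ar)
    (k : nat) (a : Sym) (Ss : seq {fset bits}) : {fset bits} :=
  dp_clean C k (\bigcup_(ws <- selections Ss) dp_step C k a ws).

(* [Clean] is not applied at the leaves. *)
Fixpoint dyn (Sym : choiceType) (ar : Sym -> nat) (C : dpcore ar) (k : nat)
    (t : term Sym) : {fset bits} :=
  match t with
  | Node a [::] => dp_leaf C k a
  | Node a ts => set_ext C k a (map (dyn C k) ts)
  end.

Definition accepted (Sym : choiceType) (ar : Sym -> nat) (C : dpcore ar)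
    (k : nat) (t : term Sym) : Prop :=
  exists2 w, w \in dyn C k t & dp_final C k w.

Definition dp_property (Sym : choiceType) (ar : Sym -> nat) (C : dpcore ar)
    (D : decomp_class ar) : set graph :=
  [set H | exists k t,
    [/\ dc_lang D k t, accepted C k t & iso (dc_graph D k t) H]]%classic.

Definition coherent (Sym : choiceType) (ar : Sym -> nat) (D : decomp_class ar)
    (C : dpcore ar) : Prop :=
  (forall k, dp_sigma C k = dc_sigma D k) /\
  (forall k k' t t', dc_lang D k t -> dc_lang D k' t' ->
    iso (dc_graph D k t) (dc_graph D k' t') ->
    (accepted C k t <-> accepted C k' t') /\
    dp_inv C k (dyn C k t) = dp_inv C k' (dyn C k' t')).

(* The invariant is a partial function with domain [dp_property C D]; outside
   it (the case P(G) = 0) the combinators receive the empty string.  On the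
   domain the value is unique when [C] is coherent. *)
Definition dp_invariant (Sym : choiceType) (ar : Sym -> nat) (C : dpcore ar)
    (D : decomp_class ar) (H : graph) : bits :=
  xget [::] [set s | dp_property C D H /\ exists k t,
    [/\ dc_lang D k t, forall j, j < k -> ~ dc_lang D j t,
        iso (dc_graph D k t) H & s = dp_inv C k (dyn C k t)]]%classic.

(** * Complexity measures *)

Definition useful_set (Sym : choiceType) (ar : Sym -> nat) (C : dpcore ar)
    (k n : nat) : set {fset bits} :=
  [set S | exists t,
    [/\ term_over ar (dp_sigma C k) t, tsize t <= n & S = dyn C k t]]%classic.

Definition useful_witness (Sym : choiceType) (ar : Sym -> nat) (C : dpcore ar)
    (k n : nat) : set bits :=
  [set w | exists2 S, useful_set C k n S & w \in S]%classic.

(* Both sets are finite (lemmas below), so [fset_set] has the same elements.  A maximum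
   over no elements is 0. *)
Definition beta (Sym : choiceType) (ar : Sym -> nat) (C : dpcore ar)
    (k n : nat) : nat :=
  \max_(w <- fset_set (useful_witness C k n)) size w.

Definition mu (Sym : choiceType) (ar : Sym -> nat) (C : dpcore ar)
    (k n : nat) : nat :=
  \max_(S <- fset_set (useful_set C k n)) #|` S|.

Definition nu (Sym : choiceType) (ar : Sym -> nat) (C : dpcore ar)
    (k n : nat) : nat :=
  #|` fset_set (useful_witness C k n)|.

Definition delta (Sym : choiceType) (ar : Sym -> nat) (C : dpcore ar)
    (k n : nat) : nat :=
  #|` fset_set (useful_set C k n)|.

Lemma finite_seqs_of (T : Type) (A : set T) (p : nat) : finite_set A ->
  finite_set [set s : seq T | size s = p /\ foldr (fun x P => A x /\ P) True s]%classic.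
Proof.
move=> fA; elim: p => [|p IHp].
  apply: (@sub_finite_set _ _ [set [::]]%classic); last exact: finite_set1.
  by move=> [|x s] [].
apply: (@sub_finite_set _ _
  ((fun u : T * seq T => u.1 :: u.2) @`
    (A `*` [set s : seq T | size s = p /\ foldr (fun x P => A x /\ P) True s]))%classic).
  by move=> [|x s] [] //= [ss] [Ax As]; exists (x, s).
by apply/finite_image/finite_setX.
Qed.

Lemma finite_terms (Sym : choiceType) (ar : Sym -> nat) (Sg : {fset Sym}) n :
  finite_set [set t | term_over ar Sg t /\ tsize t <= n]%classic.
Proof.
elim: n => [|n IHn].
  by apply: (@sub_finite_set _ _ set0); [move=> [a ts] [] | exact: finite_set0].
pose B := [set t | term_over ar Sg t /\ tsize t <= n]%classic.
apply: (@sub_finite_set _ _ (\bigcup_(a in [set` Sg])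
  (Node a @` [set s | size s = ar a /\ foldr (fun t P => B t /\ P) True s]))%classic).
  move=> [a ts] [/= /and3P[aS /eqP sz ov] le]; exists a => //.
  exists ts => //; split=> //; rewrite ltnS in le.
  elim: ts ov le {sz} => [|t ts IH] /=; first by [].
  case/andP=> ot ov le; split.
    by split=> //; apply: leq_trans le; exact: leq_addr.
  by apply: IH => //; apply: leq_trans le; exact: leq_addl.
apply: bigcup_finite; first exact: finite_fset.
by move=> a _; apply/finite_image/finite_seqs_of.
Qed.

Lemma finite_useful_set (Sym : choiceType) (ar : Sym -> nat) (C : dpcore ar)
  (k n : nat) : finite_set (useful_set C k n).
Proof.
apply: (@sub_finite_set _ _ (dyn C k @`
  [set t | term_over ar (dp_sigma C k) t /\ tsize t <= n])%classic).
  by move=> S [t [ot st ->]]; exists t.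
exact/finite_image/finite_terms.
Qed.

Lemma finite_useful_witness (Sym : choiceType) (ar : Sym -> nat)
  (C : dpcore ar) (k n : nat) : finite_set (useful_witness C k n).
Proof.
apply: (@sub_finite_set _ _
  (\bigcup_(S in useful_set C k n) [set` S])%classic).
  by move=> w [S uS wS]; exists S.
apply: bigcup_finite => [|S _]; first exact: finite_useful_set.
exact: finite_fset.
Qed.

(** * Combinators *)

Definition combinator (m : nat) : Type := m.-tuple bool -> m.-tuple bits -> bool.

Definition combine (m : nat) (c : combinator m) (P : 'I_m -> set graph)
    (phi : 'I_m -> graph -> bits) : set graph :=
  [set H | c [tuple `[< P i H >] | i < m] [tuple phi i H | i < m]]%classic.

(* Main.v *)
(* Evaluate C_1, ..., C_m in parallel, storing the tuple of all their dynamic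
   sets in a single witness, so that every useful set of C is a singleton.
   Equality in (2) forbids encoding each tuple as tightly as possible, since the
   longest witness and the largest set of C_i need not be reached on the same
   term.  Instead, a tuple first reached by a term of size r is encoded with
   length exactly sum_i (beta_i(k,r) + 1) mu_i(k,r): each bitstring becomes a
   block of length beta_i(k,r) + 1, and each set mu_i(k,r) such blocks, absent
   elements being zero blocks.  Since beta_i and mu_i are monotone in r, the
   length of a code determines the block format, hence codes are injective. *)
Require Import Defs.

Set Implicit Arguments.
Unset Strict Implicit.
Unset Printing Implicit Defensive.

Local Open Scope fset_scope.

(** * Graph isomorphism *)

Lemma fset_bij_inv (A B : {fset nat}) (f : nat -> nat) :
  {in A &, injective f} -> [fset f v | v in A] = B ->
  exists g : nat -> nat,
    [/\ {in A, cancel f g}, {in B &, injective g} & [fset g v | v in B] = A].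
Proof.
move=> finj <-.
pose g y := xget 0 [set x | x \in A /\ f x = y]%classic.
have gK : {in A, cancel f g}.
  move=> x xA; rewrite /g.
  have [] := @xgetPex _ 0 [set z | z \in A /\ f z = f x]%classic.
    by exists x.
  by move=> zA /finj; apply.
exists g; split=> //.
  by move=> _ _ /imfsetP[x /= xA ->] /imfsetP[y /= yA ->]; rewrite !gK // => ->.
apply/fsetP => x; apply/imfsetP/idP => /= [[_ /imfsetP[y /= yA ->] ->]|xA].
  by rewrite gK.
by exists (f x); [apply/imfsetP; exists x | rewrite gK].
Qed.

Lemma iso_sym (G H : graph) : iso G H -> iso H G.
Proof.
move=> [f [g [finj fV ginj gE inc]]].
have [f' [fK f'inj f'V]] := fset_bij_inv finj fV.
have [g' [gK g'inj g'E]] := fset_bij_inv ginj gE.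
exists f', g'; split=> // e v.
rewrite -fV -gE => /imfsetP[e0 /= eE ->] /imfsetP[v0 /= vV ->].
by rewrite gK // fK // inc.
Qed.

Lemma imfset_mem (A B : {fset nat}) (f : nat -> nat) x :
  [fset f v | v in A] = B -> x \in A -> f x \in B.
Proof. by move=> <- xA; apply/imfsetP; exists x. Qed.

Lemma iso_trans (G H K : graph) : iso G H -> iso H K -> iso G K.
Proof.
move=> [f [g [finj fV ginj gE inc]]] [f' [g' [f'inj f'V g'inj g'E inc']]].
have im_comp (A B A' : {fset nat}) (u u' : nat -> nat) : [fset u v | v in A] = B ->
    [fset u' v | v in B] = A' -> [fset (u' \o u) v | v in A] = A'.
  move=> <- <-; apply/fsetP => x; apply/imfsetP/imfsetP => /= -[y].
    by move=> yA ->; exists (u y) => //; apply/imfsetP; exists y.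
  by move=> /imfsetP[z /= zA ->] ->; exists z.
exists (f' \o f), (g' \o g); split.
- move=> x y xG yG /= /f'inj e.
  by apply: finj => //; apply: e; apply: imfset_mem fV _.
- exact: im_comp fV f'V.
- move=> x y xG yG /= /g'inj e.
  by apply: ginj => //; apply: e; apply: imfset_mem gE _.
- exact: im_comp gE g'E.
- move=> e v eG vG; rewrite inc // inc' //; first exact: imfset_mem gE _.
  exact: imfset_mem fV _.
Qed.

(** * Fixed-length codes *)

(** The bit [true] marks where [w] begins. It costs one bit more than [b], and it makes every block
    differ from a block of zeros, even when [w] is empty. *)
Definition pad (b : nat) (w : bits) : bits :=
  nseq (b - size w) false ++ true :: w.

Lemma size_pad b w : size w <= b -> size (pad b w) = b.+1.
Proof. by move=> le; rewrite size_cat size_nseq /= addnS subnK. Qed.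

Lemma pad_inj b : injective (pad b).
Proof.
(* The first [true] is the marker, so decoding drops everything up to and including it. This works
   for [w] of any length. *)
pose dec (s : bits) := behead (drop (find id s) s).
have decK w : dec (pad b w) = w.
  by rewrite /dec /pad find_cat has_nseq andbF /= addn0 drop_size_cat.
exact: can_inj decK.
Qed.

Definition code_seq (b n : nat) (s : seq bits) : bits :=
  let x := flatten (map (pad b) s) in x ++ nseq (n - size x) false.

Lemma size_flatten_pad b s :
  {in s, forall w, size w <= b} -> size (flatten (map (pad b) s)) = b.+1 * size s.
Proof.
elim: s => [|w s IHs] le /=; first by rewrite muln0.
rewrite size_cat size_pad ?le ?mem_head // IHs ?mulnS // => x xs.
by rewrite le // inE xs orbT.
Qed.

Lemma size_code_seq b u s : {in s, forall w, size w <= b} -> size s <= u ->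
  size (code_seq b (b.+1 * u) s) = b.+1 * u.
Proof.
move=> le su; rewrite size_cat size_nseq subnKC // size_flatten_pad //.
by rewrite leq_mul2l su orbT.
Qed.

(** Blocks all have length [b.+1], so they can be compared one by one; neither list can stop before
    the other, because the trailing zeros contain no marker. *)
Lemma code_seq_inj b n s s' :
  {in s, forall w, size w <= b} -> {in s', forall w, size w <= b} ->
  code_seq b n s = code_seq b n s' -> s = s'.
Proof.
(* The numbers of trailing zeros depend on the lists; the induction needs them arbitrary and
   independent. *)
rewrite /code_seq; move: (n - _) (n - _).
have no_block w (x : bits) k : nseq k false <> (pad b w ++ x).
  by move/(congr1 (has id)); rewrite has_nseq andbF !has_cat /= orbT.
elim: s s' => [|w s IHs] [|w' s'] k k' //= le le'.
- by rewrite -(catA (pad b w')) => /no_block.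
- by rewrite -(catA (pad b w)) => /esym/no_block.
rewrite -(catA (pad b w)) -(catA (pad b w')) => /eqP; rewrite eqseq_cat; last first.
  by rewrite !size_pad; [|apply: le'; apply: mem_head|apply: le; apply: mem_head].
case/andP => /eqP/pad_inj -> /eqP/IHs -> // x xs.
  by rewrite le // inE xs orbT.
by rewrite le' // inE xs orbT.
Qed.

(** If [u' = 0], both lists are empty. Otherwise equal products of factors ordered the same way
    force [b = b'] and [u = u'], so both codes have one format. *)
Lemma code_seq_inj_fmt b b' u u' s s' :
  {in s, forall w, size w <= b} -> {in s', forall w, size w <= b'} ->
  size s <= u -> size s' <= u' -> b <= b' -> u <= u' ->
  b.+1 * u = b'.+1 * u' ->
  code_seq b (b.+1 * u) s = code_seq b' (b'.+1 * u') s' -> s = s'.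
Proof.
move=> le le' su su' bb uu e.
case: (posnP u') => [u0|u_gt0].
  move: su su' uu; rewrite u0 !leqn0 => su /nilP -> /eqP u00 _.
  by move: su; rewrite u00 leqn0 => /nilP.
have eb : b = b'.
  apply/eqP; rewrite eqn_leq bb -ltnS -(leq_pmul2r u_gt0) -e.
  by rewrite leq_mul2l uu orbT.
rewrite -eb in le' e *; move/eqP: e; rewrite eqn_pmul2l // => /eqP <-.
exact: code_seq_inj.
Qed.

(** * Dynamization and complexity measures *)

(** Terms nest through [seq]; this induction supplies the hypothesis for every child. *)
Lemma term_ind_all (Sym : Type) (P : term Sym -> Prop) :
  (forall a ts, foldr (fun t A => P t /\ A) True ts -> P (Node a ts)) ->
  forall t, P t.
Proof.
move=> IH; fix rec 1 => -[a ts]; apply: IH.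
by elim: ts => [|t ts IHts] //=; split.
Qed.

Lemma dyn_Node (Sym : choiceType) (ar : Sym -> nat) (C : dpcore ar) k a ts :
  0 < size ts -> dyn C k (Node a ts) = set_ext C k a (map (dyn C k) ts).
Proof. by case: ts. Qed.

Lemma selections_fset1 (ws : seq bits) :
  selections (map (fun w => [fset w]) ws) = [:: ws].
Proof. by elim: ws => //= w ws ->; rewrite -fset_seq1. Qed.

Section Measures.
Variables (Sym : choiceType) (ar : Sym -> nat) (C : dpcore ar) (k : nat).

Lemma mem_useful_set n S : (S \in fset_set (useful_set C k n)) <-> useful_set C k n S.
Proof. by rewrite in_fset_set ?inE //; apply: finite_useful_set. Qed.

Lemma mem_useful_witness n w :
  (w \in fset_set (useful_witness C k n)) <-> useful_witness C k n w.
Proof. by rewrite in_fset_set ?inE //; apply: finite_useful_witness. Qed.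

Lemma beta_ge n S w : useful_set C k n S -> w \in S -> size w <= beta C k n.
Proof.
move=> uS wS; rewrite /beta; apply: (@leq_bigmax_seq _ _ xpredT size) => //.
by apply/mem_useful_witness; exists S.
Qed.

Lemma mu_ge n (S : {fset bits}) : useful_set C k n S -> #|` S| <= mu C k n.
Proof.
move=> uS; apply: (@leq_bigmax_seq _ _ xpredT (fun S : {fset bits} => #|` S|)) => //.
exact/mem_useful_set.
Qed.

Lemma beta_le n n' : (useful_set C k n `<=` useful_set C k n')%classic ->
  beta C k n <= beta C k n'.
Proof.
move=> sub; apply/bigmax_leqP_seq => w /mem_useful_witness[S /sub uS wS] _.
exact: beta_ge wS.
Qed.

Lemma mu_le n n' : (useful_set C k n `<=` useful_set C k n')%classic ->
  mu C k n <= mu C k n'.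
Proof.
by move=> sub; apply/bigmax_leqP_seq => S /mem_useful_set/sub uS _; apply: mu_ge.
Qed.

Lemma useful_set_mono n n' : n <= n' ->
  (useful_set C k n `<=` useful_set C k n')%classic.
Proof. by move=> le S [t [ot st ->]]; exists t; split=> //; apply: leq_trans le. Qed.

End Measures.

Lemma card_fset_fset1 (S : {fset bits}) : #|` [fset [fset w] | w in S]| = #|` S|.
Proof. by rewrite card_imfset //= => w w' /fset1_inj. Qed.

Lemma decidable_bits_true : decidable_bits xpredT.
Proof.
exists (Comp Succ [:: Zero]) => s /=.
apply: (@computes_comp _ _ _ [:: 0]); last exact: computes_succ.
by apply: computes_cons; [exact: computes_zero | exact: computes_nil].
Qed.

(** * The product core *)

Section Product.
Variables (Sym : choiceType) (ar : Sym -> nat) (m : nat) (c : combinator m).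
(** The alphabets are a separate parameter because for [m = 0] there is no core to read them
    from. *)
Variables (sigma : nat -> {fset Sym}) (Cs : 'I_m -> dpcore ar).
Hypothesis Cs_sigma : forall i k, dp_sigma (Cs i) k = sigma k.

Local Notation over k := (term_over ar (sigma k)).

(** * Least size of a term realising a given tuple of dynamic sets *)

Definition same_dyn k t t' := forall i, dyn (Cs i) k t = dyn (Cs i) k t'.

Lemma same_dyn_Node k a ts ts' : size ts = size ts' ->
  (forall i, map (dyn (Cs i) k) ts = map (dyn (Cs i) k) ts') ->
  same_dyn k (Node a ts) (Node a ts').
Proof.
move=> sz e i; case: (posnP (size ts)) => [s0|s_gt0].
  have /nilP -> : nilp ts by rewrite /nilp s0.
  by have /nilP -> : nilp ts' by rewrite /nilp -sz s0.
by rewrite !dyn_Node -?sz // e.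
Qed.

(** The guard [over k t] makes the predicate satisfiable for every term, so that [rank] is total. *)
Lemma rank_ex k t : exists n,
  `[< over k t -> exists t', [/\ over k t', tsize t' <= n & same_dyn k t' t] >].
Proof. by exists (tsize t); apply/asboolP => ot; exists t. Qed.

Definition rank k t := ex_minn (rank_ex k t).

Lemma rankP k t : over k t ->
  exists t', [/\ over k t', tsize t' <= rank k t & same_dyn k t' t].
Proof. by move=> ot; rewrite /rank; case: ex_minnP => r /asboolP/(_ ot). Qed.

Lemma rank_le k t t' n :
  over k t' -> tsize t' <= n -> same_dyn k t' t -> rank k t <= n.
Proof.
move=> ot' le s; rewrite /rank; case: ex_minnP => r _; apply.
by apply/asboolP => _; exists t'.
Qed.

Lemma rank_same k t t' : over k t -> over k t' -> same_dyn k t t' ->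
  rank k t = rank k t'.
Proof.
move=> ot ot' s; apply/eqP; rewrite eqn_leq; apply/andP; split.
  have [u [ou le su]] := rankP ot'.
  by apply: rank_le ou le _ => i; rewrite su s.
have [u [ou le su]] := rankP ot.
by apply: rank_le ou le _ => i; rewrite su s.
Qed.

(** * Injective codes whose length is fixed by the rank *)

Definition width k n i := (beta (Cs i) k n).+1 * mu (Cs i) k n.

Lemma width_mono k n n' i : n <= n' -> width k n i <= width k n' i.
Proof.
move=> le; have sub := @useful_set_mono _ _ (Cs i) k _ _ le.
by rewrite leq_mul // ?ltnS; [exact: beta_le | exact: mu_le].
Qed.

(** The format is taken at [rank k t] rather than [tsize t], so the code depends on a term over the
    alphabet only through its tuple of sets. Each set is read as its canonical enumeration. *)
Definition code k t : bits :=
  flatten [seq code_seq (beta (Cs i) k (rank k t)) (width k (rank k t) i)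
                        (dyn (Cs i) k t) | i <- enum 'I_m].

Lemma code_same k t t' : over k t -> over k t' -> same_dyn k t t' ->
  code k t = code k t'.
Proof.
move=> ot ot' s; rewrite /code (rank_same ot ot' s).
by congr flatten; apply: eq_map => i; rewrite s.
Qed.

Lemma dyn_useful_rank k t i : over k t ->
  useful_set (Cs i) k (rank k t) (dyn (Cs i) k t).
Proof. by move=> /rankP[t' [ot le s]]; exists t'; rewrite Cs_sigma s. Qed.

Lemma size_dyn_beta k t i : over k t ->
  {in (dyn (Cs i) k t : seq bits), forall w, size w <= beta (Cs i) k (rank k t)}.
Proof. by move=> ot w; apply: beta_ge; apply: dyn_useful_rank. Qed.

Lemma card_dyn_mu k t i : over k t ->
  size (dyn (Cs i) k t) <= mu (Cs i) k (rank k t).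
Proof. by move=> ot; apply: mu_ge; apply: dyn_useful_rank. Qed.

Lemma size_block k t i : over k t ->
  size (code_seq (beta (Cs i) k (rank k t)) (width k (rank k t) i)
                 (dyn (Cs i) k t)) = width k (rank k t) i.
Proof. by move=> ot; apply: size_code_seq; [exact: size_dyn_beta | exact: card_dyn_mu]. Qed.

Lemma size_code k t : over k t -> size (code k t) = \sum_i width k (rank k t) i.
Proof.
move=> ot; rewrite size_flatten /shape -map_comp sumnE big_map enumT.
by apply: eq_bigr => i _; rewrite /= size_block.
Qed.

Lemma code_inj k t t' : over k t -> over k t' -> code k t = code k t' ->
  same_dyn k t t'.
Proof.
wlog le : t t' / rank k t <= rank k t'.
  move=> wl ot ot' e; case/orP: (leq_total (rank k t) (rank k t')) => le.
    exact: wl.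
  by move=> i; rewrite (wl t' t).
move=> ot ot' e.
(* Equal code lengths are equal sums of widths; since the widths compare termwise, they agree
   termwise. *)
have ew i : width k (rank k t) i = width k (rank k t') i.
  have /leqif_sum[_ es] i0 : true ->
      width k (rank k t) i0 <= width k (rank k t') i0
        ?= iff (width k (rank k t) i0 == width k (rank k t') i0).
    by move=> _; split=> //; apply: width_mono.
  move/(congr1 size)/eqP: e; rewrite !size_code // es.
  by move/forallP/(_ i)/eqP.
(* The common widths cut both codes at the same places, and a finite set is recovered from its
   enumeration. *)
move: e; rewrite /code => /eq_from_flatten_shape e i; apply: val_inj => /=.
have sub := @useful_set_mono _ _ (Cs i) k _ _ le.
apply: (code_seq_inj_fmt (size_dyn_beta ot) (size_dyn_beta ot')
  (card_dyn_mu i ot) (card_dyn_mu i ot') (beta_le sub) (mu_le sub) (ew i)).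
refine (iffRL (eq_in_map _ _ _) (e _) i (mem_enum _ i)).
by rewrite /shape -!map_comp; apply: eq_map => j; rewrite /= !size_block.
Qed.

Lemma map_code_inj k ts ts' : all (over k) ts -> all (over k) ts' ->
  map (code k) ts = map (code k) ts' ->
  forall i, map (dyn (Cs i) k) ts = map (dyn (Cs i) k) ts'.
Proof.
elim: ts ts' => [|t ts IH] [|t' ts'] //= /andP[ot ots] /andP[ot' ots'] [e es] i.
by rewrite (code_inj ot ot' e) (IH ts').
Qed.

(** * The core and its runs *)

Definition combined_accepts k t : bool :=
  c [tuple `[< accepted (Cs i) k t >] | i < m]
    [tuple if `[< accepted (Cs i) k t >] then dp_inv (Cs i) k (dyn (Cs i) k t)
           else [::] | i < m].

Lemma combined_accepts_same k t t' : same_dyn k t t' ->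
  combined_accepts k t = combined_accepts k t'.
Proof.
move=> s; have acc i : accepted (Cs i) k t = accepted (Cs i) k t'.
  by rewrite /accepted s.
by rewrite /combined_accepts; congr c; apply: eq_mktuple => i; rewrite acc ?s.
Qed.

Definition prod_final k : pred bits := fun w =>
  `[< exists t, [/\ over k t, code k t = w & combined_accepts k t] >].

(** Decoding is by choice of terms with the given codes; injectivity of [code] makes the result
    independent of the choice. Strings that are not codes yield no witness. *)
Definition prod_step k (a : Sym) (ws : seq bits) : {fset bits} :=
  if pselect (exists ts, all (over k) ts /\ map (code k) ts = ws) is left h
  then [fset code k (Node a (projT1 (cid h)))] else fset0.

(** Every bitstring counts as a witness, so decidability and the closure conditions are immediate;
    the constant invariant settles that half of coherence. *)
Definition prod_core : dpcore ar.
Proof.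
refine (@DPCore _ ar sigma (fun _ => xpredT) prod_final
  (fun k a => [fset code k (Node a [::])]) prod_step (fun _ S => S)
  (fun _ _ => [::]) (fun _ => decidable_bits_true) _ _ _) => //.
Defined.

Lemma prod_step_code k a ts : a \in sigma k -> size ts = ar a ->
  all (over k) ts ->
  prod_step k a (map (code k) ts) = [fset code k (Node a ts)].
Proof.
move=> aS sz ots; rewrite /prod_step; case: pselect => [h|[]]; last by exists ts.
case: cid => ts' /= [ots' e].
have sz' : size ts' = size ts by rewrite -(size_map (code k)) e size_map.
congr [fset _]; apply: code_same; rewrite /= ?aS ?sz' ?sz ?eqxx //.
by apply: same_dyn_Node => //; apply: map_code_inj.
Qed.

(** By induction the children carry singletons, so there is exactly one selection of arguments for
    [prod_step]. *)
Lemma dyn_prod k t : over k t -> dyn prod_core k t = [fset code k t].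
Proof.
(* The leaf case holds by computation. In the other case only nonemptiness of the list of children
   is kept. *)
elim/term_ind_all: t => a [|t0 ts0] //; move: (t0 :: ts0) (isT : 0 < size (t0 :: ts0)).
move=> ts s_gt0 IH /and3P[aS /eqP sz ots]; rewrite dyn_Node //.
have -> : map (dyn prod_core k) ts = map (fun w => [fset w]) (map (code k) ts).
  elim: ts ots IH {s_gt0 sz} => //= t ts IHts /andP[ot ots] [IHt IH].
  by rewrite IHt // IHts.
by rewrite /set_ext selections_fset1 big_seq1 /= prod_step_code.
Qed.

(** [prod_final] may refer to another term with the same code; that term has the same dynamic sets,
    hence the same verdict. *)
Lemma accepted_prod k t : over k t ->
  accepted prod_core k t <-> combined_accepts k t.
Proof.
move=> ot; rewrite /accepted dyn_prod //; split.
  move=> [w /fset1P -> /asboolP[t' [ot' e]]].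
  by rewrite (combined_accepts_same (code_inj ot' ot e)).
move=> h; exists (code k t); first exact: fset11.
by apply/asboolP; exists t.
Qed.

(** * Complexity measures of the product core *)

Lemma useful_set_prod k n S : useful_set prod_core k n S <->
  exists2 w, useful_witness prod_core k n w & S = [fset w].
Proof.
split=> [[t [ot le ->]]|[w [_ [t [ot le ->]]]]].
  exists (code k t); last exact: dyn_prod.
  by exists (dyn prod_core k t); [exists t | rewrite dyn_prod // fset11].
by rewrite dyn_prod // => /fset1P -> ->; exists t; rewrite dyn_prod.
Qed.

Lemma useful_witness_prod k n w : useful_witness prod_core k n w <->
  exists t, [/\ over k t, tsize t <= n & w = code k t].
Proof.
split=> [[_ [t [ot le ->]]]|[t [ot le ->]]].
  by rewrite dyn_prod // => /fset1P ->; exists t.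
by exists (dyn prod_core k t); [exists t | rewrite dyn_prod // fset11].
Qed.

(** If no term has size at most [n], the maximum is over no sets and equals 0. *)
Lemma mu_prod k n : (exists2 t, over k t & tsize t <= n) -> mu prod_core k n = 1.
Proof.
move=> [t ot le]; apply/eqP; rewrite eqn_leq; apply/andP; split.
  apply/bigmax_leqP_seq => S /mem_useful_set/useful_set_prod[w _ ->] _.
  by rewrite cardfs1.
rewrite -(cardfs1 (code k t)) -dyn_prod //.
by apply: mu_ge; exists t.
Qed.

Lemma delta_prod k n : delta prod_core k n = nu prod_core k n.
Proof.
rewrite /nu -card_fset_fset1 /delta; congr #|` _|; apply/fsetP => S.
apply/idP/imfsetP => /= [/mem_useful_set/useful_set_prod[w uw ->]|[w uw ->]].
  by exists w => //; apply/mem_useful_witness.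
by apply/mem_useful_set/useful_set_prod; exists w => //; apply/mem_useful_witness.
Qed.

(** A code is determined by its tuple of sets, so the tuples of useful sets map onto the useful
    witnesses. *)
Lemma nu_prod k n : nu prod_core k n <= \prod_(i < m) delta (Cs i) k n.
Proof.
pose U i := fset_set (useful_set (Cs i) k n).
(* Tuples realised by no single term get the default [[::]]; they can only make the bound less
   tight. *)
pose h (x : {dffun forall i, U i}) : bits :=
  xget [::] [set w | exists t, [/\ over k t, w = code k t &
                       forall i, dyn (Cs i) k t = val (x i)]]%classic.
have -> : \prod_(i < m) delta (Cs i) k n = #|{dffun forall i, U i}|.
  rewrite card_dep_ffun foldrE big_map enumT.
  by apply: eq_bigr => i _; rewrite /delta cardfE.
apply: (@leq_trans #|` [fset h x | x in {dffun forall i, U i}]|); last first.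
  by rewrite (leq_trans (leq_imfset_card _ _ _)) //= -cardE.
apply: fsubset_leq_card; apply/fsubsetP => w.
move=> /mem_useful_witness/useful_witness_prod[t [ot le ->]].
have uS i : dyn (Cs i) k t \in U i.
  by apply/mem_useful_set; exists t; rewrite Cs_sigma.
apply/imfsetP; exists [ffun i => FSetSub (uS i)] => //=; rewrite /h.
set Q := (X in xget _ X); have [] := @xgetPex _ [::] Q.
  by exists (code k t), t; split=> // i; rewrite ffunE.
move=> t' [ot' -> e]; apply: code_same => // i.
by rewrite e ffunE.
Qed.

(** The rank of a term is at most its size, so monotone widths give the upper bound. A term of
    maximal rank among those of size at most [n] attains it. *)
Lemma beta_prod k n :
  beta prod_core k n = \sum_(i < m) (beta (Cs i) k n).+1 * mu (Cs i) k n.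
Proof.
rewrite -[RHS]/(\sum_i width k n i).
apply/eqP; rewrite eqn_leq; apply/andP; split.
  apply/bigmax_leqP_seq => w /mem_useful_witness/useful_witness_prod[t [ot le ->]] _.
  rewrite size_code //; apply: leq_sum => i _; apply: width_mono.
  exact: rank_le ot le _.
(* Without terms of size at most [n], every [mu (Cs i) k n] is an empty maximum, and the sum
   vanishes. *)
have [ex|nex] := pselect (exists t, over k t /\ tsize t <= n); last first.
  rewrite big1 // => i _; rewrite /width; suff -> : mu (Cs i) k n = 0 by rewrite muln0.
  apply/eqP; rewrite -leqn0; apply/bigmax_leqP_seq => S /mem_useful_set[t [ot le _]] _.
  by case: nex; exists t; rewrite -(Cs_sigma i).
pose P r := `[< exists t, [/\ over k t, tsize t <= n & rank k t = r] >].
have exP : exists r, P r.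
  by case: ex => t [ot le]; exists (rank k t); apply/asboolP; exists t.
have ubP r : P r -> r <= n.
  by move/asboolP => [t [ot le <-]]; apply: rank_le ot le _.
case: (ex_maxnP exP ubP) => r /asboolP[t [ot le rt]] maxr.
(* A set reached within size [n] is already reached within the rank of its term, which is at most
   [r]; so the measures at [n] do not exceed those at [r]. *)
have sub i : (useful_set (Cs i) k n `<=` useful_set (Cs i) k r)%classic.
  move=> S [t' [ot' le' ->]]; rewrite Cs_sigma in ot'.
  apply: (useful_set_mono _ (dyn_useful_rank i ot')).
  by apply: maxr; apply/asboolP; exists t'.
apply: (@leq_trans (size (code k t))).
  rewrite size_code // rt; apply: leq_sum => i _.
  by rewrite leq_mul // ?ltnS; [exact: beta_le | exact: mu_le].
apply: beta_ge (fset11 _); rewrite -dyn_prod //.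
by exists t.
Qed.

End Product.

(** * Coherence and the combined property *)

Section Coherence.
Variables (Sym : choiceType) (ar : Sym -> nat) (D : decomp_class ar).

Lemma dc_lang_over k t : dc_lang D k t -> term_over ar (dc_sigma D k) t.
Proof. by have [Q [A L]] := dc_regular D k; move/L => []. Qed.

(** [dp_invariant] reads a term at its least index; since the graph maps extend one another, the
    graph there is the one at [k]. *)
Lemma dc_lang_least k t : dc_lang D k t -> exists j,
  [/\ dc_lang D j t, forall i, i < j -> ~ dc_lang D i t &
      dc_graph D j t = dc_graph D k t].
Proof.
move=> Lt.
have ex : exists j, `[< dc_lang D j t >] by exists k; apply/asboolP.
case: (ex_minnP ex) => j /asboolP Lj minj; exists j; split=> //.
  by move=> i ij /asboolP/minj; rewrite leqNgt ij.
have jk : j <= k by apply: minj; apply/asboolP.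
suff H d : dc_lang D (j + d) t /\ dc_graph D (j + d) t = dc_graph D j t.
  by have [_] := H (k - j); rewrite subnKC.
elim: d => [|d [Ld e]]; first by rewrite addn0.
rewrite addnS; split; first exact: dc_lang_sub.
by rewrite dc_graph_ext.
Qed.

Variable C : dpcore ar.
Hypothesis C_coh : coherent D C.

Lemma dp_propertyE k t H : dc_lang D k t -> iso (dc_graph D k t) H ->
  dp_property C D H <-> accepted C k t.
Proof.
move=> Lt tH; split=> [[k' [t' [Lt' acc t'H]]]|acc]; last by exists k, t.
have /iso_trans/(_ (iso_sym t'H)) := tH.
by case/(C_coh.2 _ _ _ _ Lt Lt') => -[_ bwd] _; apply: bwd.
Qed.

(** Coherence makes all candidate values equal. When [t] is rejected there are none, and [xget]
    returns [[::]], the string that [combined_accepts] supplies in this case. *)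
Lemma dp_invariantE k t H : dc_lang D k t -> iso (dc_graph D k t) H ->
  dp_invariant C D H =
    if `[< accepted C k t >] then dp_inv C k (dyn C k t) else [::].
Proof.
move=> Lt tH; rewrite /dp_invariant; case: asboolP => acc; last first.
  by apply: xgetPN => s [/(dp_propertyE Lt tH)].
set Q := (X in xget _ X); have [] := @xgetPex _ [::] Q.
  have [j [Lj minj e]] := dc_lang_least Lt.
  exists (dp_inv C j (dyn C j t)); split; first exact/(dp_propertyE Lt tH).
  by exists j, t; rewrite e.
move=> _ [k' [t' [Lt' _ t'H ->]]].
by case: (C_coh.2 _ _ _ _ Lt' Lt (iso_trans t'H (iso_sym tH))).
Qed.

End Coherence.

(** The property is intersected with [dc_graphs D] because a combinator may accept graphs without a
    decomposition. The successor on [beta] pays for the marker bit: if the useful sets of a single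
    core are the empty set and the singleton of [[::]], then [beta * mu = 0] would leave both with
    one code. *)
Theorem theorem7 (Sym : choiceType) (ar : Sym -> nat) (m : nat)
    (c : combinator m) (D : decomp_class ar) (Cs : 'I_m -> dpcore ar)
    (Cs_coherent : forall i, coherent D (Cs i)) :
  exists C : dpcore ar,
    coherent D C /\
    dp_property C D =
      (dc_graphs D `&` combine c (fun i => dp_property (Cs i) D)
                                 (fun i => dp_invariant (Cs i) D))%classic /\
    (forall k n, beta C k n = \sum_(i < m) (beta (Cs i) k n).+1 * mu (Cs i) k n) /\
    (forall k n,
      (exists2 t, term_over ar (dc_sigma D k) t & tsize t <= n) ->
      mu C k n = 1) /\
    (forall k n, delta C k n = nu C k n /\
      nu C k n <= \prod_(i < m) delta (Cs i) k n).
Proof.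
have sig i k : dp_sigma (Cs i) k = dc_sigma D k by case: (Cs_coherent i).
have combineE k t H : dc_lang D k t -> iso (dc_graph D k t) H ->
    combine c (fun i => dp_property (Cs i) D)
              (fun i => dp_invariant (Cs i) D) H = combined_accepts c Cs k t.
  move=> Lt tH; rewrite /combine /combined_accepts /=.
  congr (is_true (c _ _)); apply: eq_mktuple => i.
    by apply: asbool_equiv_eq; apply: dp_propertyE.
  exact: dp_invariantE.
exists (prod_core c (dc_sigma D) Cs); split; [|split; [|split; [|split]]].
- split=> // k k' t t' Lt Lt' tt'; split=> //.
  rewrite !accepted_prod //; try exact: dc_lang_over.
  have refl : iso (dc_graph D k' t') (dc_graph D k' t').
    exact: iso_trans (iso_sym tt') tt'.
  (* Both verdicts are the value of the combinator at the graph of [t']. *)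
  by rewrite -(combineE _ _ _ Lt tt') (combineE _ _ _ Lt' refl).
- apply/seteqP; split=> H.
    move=> [k [t [Lt acc tH]]]; split; first by exists k, t.
    by rewrite (combineE k t) //; apply/accepted_prod => //; apply: dc_lang_over.
  move=> [[k [t [Lt tH]]]]; rewrite (combineE k t) // => acc.
  by exists k, t; split=> //; apply/accepted_prod => //; apply: dc_lang_over.
- by move=> k n; apply: beta_prod.
- by move=> k n; apply: mu_prod.
- by move=> k n; split; [exact: delta_prod | exact: nu_prod].
Qed.
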